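(* Let $\mathbb{K}\in\{\mathbb{K}_c,\mathbb{K}_v,\mathbb{K}_o,\mathbb{K}_s,\mathbb{K}_d\}$, let $f,F_{1,i},F_{2,i}:\mathbb{R}^n\to\mathbb{R}$, $i=1,\ldots,m$, be twice continuously differentiable, let $M=\{x\in\mathbb{R}^n \mid (F_{1,i}(x),F_{2,i}(x))\in\mathbb{K},\ i=1,\ldots,m\}$, and let $\bar x\in M$ satisfy SNO-LICQ and $F_{1,i}(\bar x)=F_{2,i}(\bar x)=0$ for all $i=1,\ldots,m$. Suppose that $\bar x$ is a T-stationary point of the problem $\min_x f(x)$ s.t. $x\in M$. Then $\bar x$ is not $\widehat N$-stationary if and only if $\bar x$ is a saddle point of first order.
   Context: Cones in $\mathbb{R}^2$: $\mathbb{K}_c=\{(a_1,a_2)\mid a_1a_2=0,\ a_1\ge 0,\ a_2\ge 0\}$ (complementarity, MPCC); $\mathbb{K}_v=\{(a_1,a_2)\mid a_1\ge 0,\ a_1a_2\le 0\}$ (vanishing, MPVC); $\mathbb{K}_o=\{(a_1,a_2)\mid a_1a_2=0,\ a_2\ge 0\}$ (orthogonality type, MPOC); $\mathbb{K}_s=\{(a_1,a_2)\mid a_1a_2=0\}$ (switching, MPSC); $\mathbb{K}_d=\{(a_1,a_2)\mid a_1\ge 0\text{ or }a_2\ge 0\}$ (disjunctive, MPDC). The problem SNO is: minimize $f(x)$ subject to $x\in M$. SNO-LICQ at $\bar x\in M$: the vectors $\nabla F_{1,i}(\bar x)$ for $i\in\{1,\ldots,m\}$ with $F_{1,i}(\bar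 x)=0$, together with $\nabla F_{2,i}(\bar x)$ for $i\in\{1,\ldots,m\}$ with $F_{2,i}(\bar x)=0$, are linearly independent. Biactive index set: $I_{00}(\bar x)=\{i\in\{1,\ldots,m\}\mid F_{1,i}(\bar x)=0,\ F_{2,i}(\bar x)=0\}$; it is assumed throughout that $I_{00}(\bar x)=\{1,\ldots,m\}$. The tangential cone $T_M(\bar x)$ consists of all $w$ for which there exist $x^k\to\bar x$ with $x^k\in M$ and $\tau^k\searrow 0$ such that $(x^k-\bar x)/\tau^k\to w$. The Fréchet normal cone is $\widehat N_M(\bar x)=\{v\mid \langle v,w\rangle\le 0\text{ for all }w\in T_M(\bar x)\}$. The point $\bar x\in M$ is called $\widehat N$-stationary if $0\in\nabla f(\bar x)+\widehat N_M(\bar x)$. The point $\bar x\in M$ is called T-stationary if there are multipliers $\lambda_{1,i},\lambda_{2,i}\in\mathbb{R}$, $i\in I_{00}(\bar x)$ (unique under SNO-LICQ), with $$\nabla f(\bar x)=\sum_{i\in I_{00}(\bar x)}\bigl(\lambda_{1,i}\nabla F_{1,i}(\bar x)+\lambda_{2,i}\nabla F_{2,i}(\bar x)\bigr)$$ such that for all $i\in I_{00}(\bar x)$: if $\mathbb{K}=\mathbb{K}_c$: $\lambda_{1,i}\lambda_{2,i}\ge 0$; if $\mathbb{K}=\mathbb{K}_v$: $\lambda_{1,i}\lambda_{2,i}\ge 0$ and $\lambda_{2,i}\le 0$; if $\mathbb{K}=\mathbb{K}_o$: $\lambda_{1,i}=0$ or $\lambda_{2,i}\le 0$; if $\mathbb{K}=\mathbb{K}_s$: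 no restriction; if $\mathbb{K}=\mathbb{K}_d$: $\lambda_{1,i}\ge 0$ and $\lambda_{2,i}\ge 0$. A T-stationary point $\bar x\in M$ with multipliers $\lambda_{1,i},\lambda_{2,i}$ is called a saddle point of first order if for some $i\in I_{00}(\bar x)$ one has $(\lambda_{1,i},\lambda_{2,i})\ne(0,0)$ and, in addition: if $\mathbb{K}=\mathbb{K}_c$: $\lambda_{1,i}\le 0$ and $\lambda_{2,i}\le 0$; if $\mathbb{K}=\mathbb{K}_v$: $\lambda_{1,i}\le 0$ and $\lambda_{2,i}\le 0$; if $\mathbb{K}=\mathbb{K}_o$: $\lambda_{2,i}\le 0$; if $\mathbb{K}=\mathbb{K}_s$: no further restriction; if $\mathbb{K}=\mathbb{K}_d$: $\lambda_{1,i}\ge 0$ and $\lambda_{2,i}\ge 0$. *)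

(* Defs.v *)
From mathcomp Require Import all_boot all_order all_algebra.
From mathcomp Require Import all_classical all_reals all_analysis.

Set Implicit Arguments.
Unset Strict Implicit.
Unset Printing Implicit Defensive.

Import Order.TTheory GRing.Theory Num.Theory.
Import numFieldNormedType.Exports.

Local Open Scope classical_set_scope.
Local Open Scope ring_scope.

Definition inner (R : realType) (n : nat) (u v : 'rV[R]_n) : R :=
  \sum_(j < n) u 0 j * v 0 j.

Definition gradient (R : realType) (n : nat) (f : 'rV[R]_n -> R)
    (x : 'rV[R]_n) : 'rV[R]_n :=
  \row_(j < n) 'D_(delta_mx 0 j) f x.

(* Twice (Frechet) differentiable everywhere, with a continuous Hessian, the
   latter being the Jacobian matrix of the gradient map. *)
Definition twice_continuously_differentiable (R : realType) (n : nat)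
    (f : 'rV[R]_n -> R) : Prop :=
  [/\ (forall x, differentiable f x),
      (forall x, differentiable (gradient f) x)
    & continuous (fun x => jacobian (gradient f) x)].

Definition tangent_cone (R : realType) (n : nat) (A : set 'rV[R]_n)
    (xbar : 'rV[R]_n) : set 'rV[R]_n :=
  [set w | exists (x : nat -> 'rV[R]_n) (tau : nat -> R),
     [/\ (forall k, A (x k)), (x k @[k --> \oo] --> xbar),
         (forall k, 0 < tau k), (tau k @[k --> \oo] --> (0 : R))
       & ((tau k)^-1 *: (x k - xbar) @[k --> \oo] --> w)]].

Definition frechet_normal_cone (R : realType) (n : nat) (A : set 'rV[R]_n)
    (xbar : 'rV[R]_n) : set 'rV[R]_n :=
  [set v | forall w, tangent_cone A xbar w -> inner v w <= 0].

Definition frechet_stationary (R : realType) (n : nat) (f : 'rV[R]_n -> R)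
    (A : set 'rV[R]_n) (xbar : 'rV[R]_n) : Prop :=
  A xbar /\
  (exists2 v, frechet_normal_cone A xbar v & 0 = gradient f xbar + v).

(* Complementarity, vanishing, orthogonality type, switching, disjunctive. *)
Inductive sno_type := MPCC | MPVC | MPOC | MPSC | MPDC.

Definition cone (R : realType) (K : sno_type) : set (R * R) :=
  match K with
  | MPCC => [set a | [/\ a.1 * a.2 = 0, 0 <= a.1 & 0 <= a.2]]
  | MPVC => [set a | 0 <= a.1 /\ a.1 * a.2 <= 0]
  | MPOC => [set a | a.1 * a.2 = 0 /\ 0 <= a.2]
  | MPSC => [set a | a.1 * a.2 = 0]
  | MPDC => [set a | 0 <= a.1 \/ 0 <= a.2]
  end.

Definition feasible (R : realType) (n m : nat) (K : sno_type)
    (F1 F2 : 'I_m -> 'rV[R]_n -> R) : set 'rV[R]_n :=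
  [set x | forall i, cone K (F1 i x, F2 i x)].

(* Independence is that of the family: a repeated vector makes it dependent. *)
Definition sno_licq (R : realType) (n m : nat)
    (F1 F2 : 'I_m -> 'rV[R]_n -> R) (xbar : 'rV[R]_n) : Prop :=
  free ([seq gradient (F1 i) xbar | i <- enum 'I_m & F1 i xbar == 0] ++
        [seq gradient (F2 i) xbar | i <- enum 'I_m & F2 i xbar == 0]).

Definition biactive (R : realType) (n m : nat)
    (F1 F2 : 'I_m -> 'rV[R]_n -> R) (xbar : 'rV[R]_n) : {set 'I_m} :=
  [set i | (F1 i xbar == 0) && (F2 i xbar == 0)]%SET.

Definition T_sign (R : realType) (K : sno_type) (l1 l2 : R) : Prop :=
  match K with
  | MPCC => 0 <= l1 * l2
  | MPVC => 0 <= l1 * l2 /\ l2 <= 0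
  | MPOC => l1 = 0 \/ l2 <= 0
  | MPSC => True
  | MPDC => 0 <= l1 /\ 0 <= l2
  end.

(* Only biactive constraints carry multipliers: this is T-stationarity under
   the standing assumption that every constraint is biactive at xbar.  Values
   of l1 and l2 outside the biactive index set are irrelevant. *)
Definition T_multipliers (R : realType) (n m : nat) (K : sno_type)
    (f : 'rV[R]_n -> R) (F1 F2 : 'I_m -> 'rV[R]_n -> R) (xbar : 'rV[R]_n)
    (l1 l2 : 'I_m -> R) : Prop :=
  gradient f xbar =
    \sum_(i in biactive F1 F2 xbar)
      (l1 i *: gradient (F1 i) xbar + l2 i *: gradient (F2 i) xbar) /\
  (forall i, i \in biactive F1 F2 xbar -> T_sign K (l1 i) (l2 i)).

Definition T_stationary (R : realType) (n m : nat) (K : sno_type)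
    (f : 'rV[R]_n -> R) (F1 F2 : 'I_m -> 'rV[R]_n -> R)
    (xbar : 'rV[R]_n) : Prop :=
  feasible K F1 F2 xbar /\
  (exists l1 l2 : 'I_m -> R, T_multipliers K f F1 F2 xbar l1 l2).

Definition saddle_sign (R : realType) (K : sno_type) (l1 l2 : R) : Prop :=
  match K with
  | MPCC => l1 <= 0 /\ l2 <= 0
  | MPVC => l1 <= 0 /\ l2 <= 0
  | MPOC => l2 <= 0
  | MPSC => True
  | MPDC => 0 <= l1 /\ 0 <= l2
  end.

(* Under sno_licq the multipliers are unique on the biactive index set, so
   quantifying them existentially is the same as fixing them. *)
Definition first_order_saddle (R : realType) (n m : nat) (K : sno_type)
    (f : 'rV[R]_n -> R) (F1 F2 : 'I_m -> 'rV[R]_n -> R)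
    (xbar : 'rV[R]_n) : Prop :=
  feasible K F1 F2 xbar /\
  (exists l1 l2 : 'I_m -> R,
     T_multipliers K f F1 F2 xbar l1 l2 /\
     exists i, [/\ i \in biactive F1 F2 xbar,
                   (l1 i, l2 i) <> (0, 0)
                 & saddle_sign K (l1 i) (l2 i)]).

(* Main.v *)
Require Import Defs.
From HB Require Import structures.
From mathcomp Require Import all_boot all_order all_algebra.
From mathcomp Require Import all_classical all_reals all_analysis.
From mathcomp Require Import ring lra.

Import Order.TTheory GRing.Theory Num.Theory.
Import numFieldNormedType.Exports.
Local Open Scope classical_set_scope.
Local Open Scope ring_scope.

Set Implicit Arguments.
Unset Strict Implicit.

(** Let [G] be the map of all constraint functions, [L] its Jacobian at [xbar],
    and [l] the multipliers.  As the gradient of [f] is the combination of the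
    constraint gradients with coefficients [l], the slope of [f] in a direction
    [w] is the pairing of [l] with the linearised values [w *m L]
    ([inner_multipliers]).  Frechet stationarity says that this slope is
    nonnegative on the tangent cone.

    Under linear independence the tangent cone consists of the [w] for which
    every pair of linearised values lies in the cone [K], and [w *m L] can be
    prescribed at will.  Frechet stationarity therefore means that every pair of
    multipliers lies in the dual cone of [K].  Among the pairs with T-stationary
    signs, those outside the dual cone are exactly the nonzero pairs with saddle
    signs ([pairing_ge0_cone], [descent_in_cone]).

    If there is no saddle pair and [w] is tangent along points [x k] with steps
    [tau k], then the rescaled pairs [(tau k)^-1 *: G (x k)] lie in [K], pair
    nonnegatively with [l], and converge to [w *m L]
    ([strict_derivative_tangent]).  If there is a saddle pair, one picks [w]
    whose linearised values vanish except at that pair, where they form a vector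
    of [K] on which the pairing is negative.  What has to be shown is that [w]
    is tangent to the feasible set, and this is the analytic core: Lyusternik's
    theorem ([lyusternik], [lyusternik_tangent_cone]) solves
    [G x = t *: (w *m L)] exactly, with [x] at distance o(t) from
    [xbar + t *: w], by a Banach fixed-point argument.  Such points are feasible
    because [K] is a cone.  The contraction property rests on strict
    differentiability, which follows from continuity of the gradients
    ([strict_differentiability]). *)

(** * Sup-norm estimates *)

Lemma mx_norm_entry (R : realType) (p q : nat) (A : 'M[R]_(p, q)) i j :
  `|A i j| <= `|A|.
Proof.
rewrite /Num.norm/= mx_normrE.
exact: (le_bigmax_cond 0 (fun ij : 'I_p * 'I_q => `|A ij.1 ij.2|)
                       (j := (i, j))).
Qed.

Lemma mx_norm_le (R : realType) (p q : nat) (A : 'M[R]_(p, q)) (c : R) :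
  0 <= c -> (forall i j, `|A i j| <= c) -> `|A| <= c.
Proof.
by move=> c0 Ac; rewrite /Num.norm/= mx_normrE; apply: bigmax_le => // -[i j] _.
Qed.

Lemma ler_norm_sumM (R : realType) (n : nat) (a b : 'I_n -> R) (c d : R) :
  0 <= c -> (forall k, `|a k| <= c) -> (forall k, `|b k| <= d) ->
  `|\sum_k a k * b k| <= n%:R * c * d.
Proof.
move=> c0 ac bd; apply: (le_trans (ler_norm_sum _ _ _)).
apply: (@le_trans _ _ (\sum_(k < n) c * d)); last first.
  by rewrite sumr_const card_ord -mulrA mulr_natl.
by apply: ler_sum => k _; rewrite normrM ler_pM.
Qed.

Lemma ler_norm_inner (R : realType) (n : nat) (u v : 'rV[R]_n) :
  `|inner u v| <= n%:R * `|u| * `|v|.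
Proof. by apply: ler_norm_sumM => // k; exact: mx_norm_entry. Qed.

Lemma innerN (R : realType) (n : nat) (u v : 'rV[R]_n) :
  inner (- u) v = - inner u v.
Proof.
by rewrite /inner -sumrN; apply: eq_bigr => k _; rewrite mxE mulNr.
Qed.

Lemma ler_norm_mulmx (R : realType) (p q : nat) (u : 'rV[R]_p)
  (A : 'M[R]_(p, q)) : `|u *m A| <= p%:R * `|u| * `|A|.
Proof.
apply: mx_norm_le => [|i j]; first by rewrite !mulr_ge0.
by rewrite mxE; apply: ler_norm_sumM => // k; exact: mx_norm_entry.
Qed.

(** * Strict differentiability from a continuous gradient *)

Lemma derive_inner (R : realType) (n : nat) (F : 'rV[R]_n -> R)
    (x v : 'rV[R]_n) :
  differentiable F x -> 'D_v F x = inner (gradient F x) v.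
Proof.
move=> dF; rewrite (deriveE _ dF) [in LHS](row_sum_delta v) linear_sum.
apply: eq_bigr => j _; rewrite linearZ/= mxE deriveE//.
by rewrite mulrC.
Qed.

(** The one-variable mean value theorem, applied along the segment from [y] to
    [x]: the difference quotients of [t |-> F (y + t *: (x - y))] are those of
    [F] in the direction [x - y]. *)
Lemma mean_value_inner (R : realType) (n : nat) (F : 'rV[R]_n -> R)
    (x y : 'rV[R]_n) : (forall z, differentiable F z) ->
  exists2 c : R, 0 <= c <= 1 &
    F x - F y = inner (gradient F (y + c *: (x - y))) (x - y).
Proof.
move=> dF; pose v := x - y; pose g (t : R) := F (y + t *: v).
have g' (t : R) : is_derive t 1 g (inner (gradient F (y + t *: v)) v).
  have E : (fun h : R => h^-1 *: ((g \o shift t) (h *: 1) - g t)) =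
      (fun h : R => h^-1 *: ((F \o shift (y + t *: v)) (h *: v) -
                             F (y + t *: v))).
    apply/funext => h /=; congr (_ *: (F _ - _)).
    by rewrite scaler1 scalerDl addrCA.
  apply: DeriveDef; first by rewrite /derivable E; apply: diff_derivable.
  by rewrite -derive_inner// /derive E.
have [|c c01] := @MVT_segment _ g _ 0 1 ler01 (fun t _ => g' t).
  apply: continuous_subspaceT => t; apply: differentiable_continuous.
  by apply/derivable1_diffP; have [] := g' t.
rewrite subr0 mulr1 /g scale1r scale0r addr0 /v (addrC y (x - y)) subrK => E.
by exists c => //; move: c01; rewrite in_itv.
Qed.

(** The estimate holds for all pairs of points near [xbar], and not merely for
    [y = xbar] as for a Frechet derivative: the mean value point of the segment
    lies in the same ball, where the gradient is close to its value at [xbar].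
    Uniformity in both points is what makes the fixed-point map of [lyusternik]
    a contraction. *)
Lemma strict_differentiability (R : realType) (n : nat) (F : 'rV[R]_n -> R)
    (xbar : 'rV[R]_n) (e : R) :
  (forall x, differentiable F x) -> {for xbar, continuous (gradient F)} ->
  0 < e ->
  exists2 d : R, 0 < d & forall x y, `|x - xbar| < d -> `|y - xbar| < d ->
    `|F x - F y - inner (gradient F xbar) (x - y)| <= e * `|x - y|.
Proof.
move=> dF cF e0.
have e1 : 0 < e / n.+1%:R by rewrite divr_gt0.
have /cvgrPdist_lt /(_ _ e1) /nbhs_normP [d /= d0 hd] := cF.
exists d => // x y xd yd.
have [c /andP[c0 c1] ->] := mean_value_inner x y dF.
set z := y + _.
have zd : `|z - xbar| < d.
  have -> : z - xbar = c *: (x - xbar) + (1 - c) *: (y - xbar).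
    by apply/matrixP => i j; rewrite /z !mxE; ring.
  apply: (le_lt_trans (ler_normD _ _)).
  rewrite !normrZ (ger0_norm c0) ger0_norm ?subr_ge0//.
  set M := Num.max `|x - xbar| `|y - xbar|.
  have Md : M < d by rewrite gt_max xd.
  apply: le_lt_trans Md; have -> : M = c * M + (1 - c) * M by ring.
  by rewrite lerD// ler_wpM2l ?subr_ge0// le_max lexx ?orbT.
have -> : inner (gradient F z) (x - y) - inner (gradient F xbar) (x - y) =
    inner (gradient F z - gradient F xbar) (x - y).
  by rewrite /inner -sumrB; apply: eq_bigr => j _; rewrite !mxE mulrBl.
apply: (le_trans (ler_norm_inner _ _)); rewrite ler_wpM2r//.
have /= := hd z; rewrite /ball_/= distrC => /(_ zd) /ltW; rewrite distrC.
rewrite ler_pdivlMr// => h.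
apply: le_trans h; rewrite mulrC ler_wpM2l// ler_nat//.
Qed.

(** * Solving G x = t *: (w *m L) near a point where L is onto *)

(* Joins the uniform completeness of row vectors with their norm, so that the
   Banach fixed-point theorem applies to them. *)
HB.instance Definition _ (R : realType) (n : nat) := Complete.on 'rV[R]_n.

(** Vectors are rows, so the Jacobian [L] acts on the right. *)
Definition strict_derivative (R : realType) (n p : nat)
    (G : 'rV[R]_n -> 'rV[R]_p) (xbar : 'rV[R]_n) (L : 'M[R]_(n, p)) : Prop :=
  forall e : R, 0 < e ->
  exists2 d : R, 0 < d & forall x y, `|x - xbar| < d -> `|y - xbar| < d ->
    `|G x - G y - (x - y) *m L| <= e * `|x - y|.

Lemma halving_fixed_point (R : realType) (p : nat) (rho : R)
    (Phi : 'rV[R]_p -> 'rV[R]_p) :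
  0 <= rho ->
  (forall u, `|u| <= rho -> `|Phi u| <= rho) ->
  (forall u v, `|u| <= rho -> `|v| <= rho ->
     `|Phi u - Phi v| <= 2^-1 * `|u - v|) ->
  exists2 u, `|u| <= rho & u = Phi u.
Proof.
move=> rho0 maps contr; pose U := closed_ball_ Num.norm (0 : 'rV[R]_p) rho.
have UE u : U u <-> `|u| <= rho by rewrite /U /closed_ball_/= sub0r normrN.
have PhiU : isFun _ _ U U Phi by split=> u /UE Uu; apply/UE/maps.
pose Psi : {fun U >-> U} := HB.pack Phi PhiU.
have [|||u /UE Uu uE] := @banach_fixed_point _ _ U Psi.
- exists 2^-1%:nng; split; first by rewrite /= invf_lt1// ltr1n.
  by move=> [u v] /= [/UE Uu /UE Uv]; exact: contr.
- exact: closed_closed_ball_.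
- by exists 0; apply/UE; rewrite normr0.
- by exists u.
Qed.

(** If the Jacobian [L] has a left inverse [A], then [x] can be sought as
    [xbar + t *: w + u *m A], for which [(x - xbar) *m L = t *: (w *m L) + u].
    With [rem x] the error of linearisation of [G], the equation
    [G x = t *: (w *m L)] becomes the fixed-point problem [u = - rem x].  As
    [rem] has an arbitrarily small Lipschitz constant near [xbar] and vanishes
    there, the right-hand side contracts a ball whose radius is an arbitrarily
    small multiple of [t], which gives [u = o(t)]. *)
Lemma lyusternik (R : realType) (n p : nat) (G : 'rV[R]_n -> 'rV[R]_p)
    (xbar : 'rV[R]_n) (L : 'M[R]_(n, p)) (A : 'M[R]_(p, n)) (w : 'rV[R]_n)
    (e : R) :
  G xbar = 0 -> strict_derivative G xbar L -> A *m L = 1%:M -> 0 < e ->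
  exists (t : R) (x : 'rV[R]_n),
    [/\ 0 < t, t < e, `|x - xbar - t *: w| <= e * t & G x = t *: (w *m L)].
Proof.
move=> G0 strictG AL e0.
pose k := p%:R * `|A|; pose W := `|w|.
have k0 : 0 <= k by rewrite mulr_ge0.
have W0 : 0 <= W by exact: normr_ge0.
have kA (u : 'rV[R]_p) : `|u *m A| <= k * `|u|.
  by rewrite /k mulrAC ler_norm_mulmx.
(* [eta] is the Lipschitz constant to be imposed on the error term.  The bound
   1/2 on [eta * k] makes the map a contraction, the bound [e / 2] on
   [eta * k * W] gives the final estimate; the added ones avoid a division by
   zero. *)
pose c := Num.min (2^-1) (e / 2).
have c0 : 0 < c by rewrite lt_min invr_gt0 ltr0n divr_gt0.
pose eta := c / ((k + 1) * (W + 1)).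
have D0 : 0 < (k + 1) * (W + 1) by rewrite mulr_gt0// ltr_wpDl.
have eta0 : 0 < eta by rewrite divr_gt0.
have etaE : eta * ((k + 1) * (W + 1)) = c by rewrite /eta divfK// gt_eqF.
have eta_k : eta * k <= 2^-1.
  apply: (@le_trans _ _ c); last by rewrite /c ge_min lexx.
  by rewrite -etaE ler_wpM2l ?(ltW eta0)//; nra.
have eta_kW : eta * k * W <= e / 2.
  apply: (@le_trans _ _ c); last by rewrite /c ge_min lexx orbT.
  by rewrite -etaE -mulrA ler_wpM2l ?(ltW eta0)//; nra.
have [d d0 Gd] := strictG _ eta0.
(* Every point visited stays within [2 * t * W] of [xbar], hence in the ball
   of radius [d] where [eta] is valid. *)
pose t := Num.min (e / 2) (d / (2 * W + 1)).
have W1 : 0 < 2 * W + 1 by rewrite ltr_wpDl// mulr_ge0.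
have t0 : 0 < t by rewrite lt_min !divr_gt0.
have te : t < e by rewrite gt_min; apply/orP; left; lra.
have td : t * (2 * W) < d.
  have : t * (2 * W + 1) <= d by rewrite -ler_pdivlMr// ge_min lexx orbT.
  by lra.
pose rho := 2 * eta * t * W.
have rho0 : 0 <= rho.
  by rewrite mulr_ge0// mulr_ge0 ?(ltW t0)// mulr_ge0 ?(ltW eta0).
pose X u := xbar + (t *: w + u *m A).
have Xclose u : `|u| <= rho -> `|X u - xbar| <= t * (2 * W).
  move=> u_rho; have -> : X u - xbar = t *: w + u *m A.
    by rewrite /X addrAC subrr add0r.
  apply: (le_trans (ler_normD _ _)); rewrite normrZ gtr0_norm// -/W.
  have := le_trans (kA u) (ler_wpM2l k0 u_rho).
  have : k * rho <= t * W.
    have -> : k * rho = 2 * (eta * k) * (t * W) by rewrite /rho; ring.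
    by rewrite ler_piMl ?mulr_ge0// ?(ltW t0)//; lra.
  move=> h1 h2; apply: (@le_trans _ _ (t * W + t * W)); last lra.
  exact: lerD (le_trans h2 h1).
have Xd u : `|u| <= rho -> `|X u - xbar| < d.
  by move=> /Xclose h; exact: le_lt_trans td.
pose rem x := G x - (x - xbar) *m L.
have rem_lip x y : `|x - xbar| < d -> `|y - xbar| < d ->
    `|rem x - rem y| <= eta * `|x - y|.
  move=> xd yd; apply: le_trans (Gd x y xd yd).
  rewrite le_eqVlt; apply/orP; left; apply/eqP; congr `|_|; rewrite /rem.
  have -> : x - y = (x - xbar) - (y - xbar) by rewrite opprB addrA subrK.
  rewrite [(x - xbar - _) *m L]mulmxBl.
  by apply/matrixP => i j; rewrite !mxE; ring.
have rem0 : rem xbar = 0 by rewrite /rem G0 subrr mul0mx subr0.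
have [||u u_rho uE] := halving_fixed_point (Phi := fun u => - rem (X u)) rho0.
- move=> u u_rho; rewrite normrN -[rem _]subr0 -rem0.
  apply: le_trans (rem_lip _ _ (Xd _ u_rho) _) _; first by rewrite subrr normr0.
  apply: (@le_trans _ _ (eta * (t * (2 * W)))); last by rewrite /rho; lra.
  by rewrite ler_wpM2l ?(ltW eta0)// Xclose.
- move=> u v u_rho v_rho; rewrite -opprD normrN.
  apply: le_trans (rem_lip _ _ (Xd _ u_rho) (Xd _ v_rho)) _.
  have -> : X u - X v = (u - v) *m A.
    by rewrite mulmxBl; apply/matrixP => i j; rewrite /X !mxE; ring.
  apply: (@le_trans _ _ (eta * (k * `|u - v|))).
    by rewrite ler_wpM2l ?(ltW eta0).
  by rewrite mulrA ler_wpM2r.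
exists t, (X u); split => //.
  have -> : X u - xbar - t *: w = u *m A.
    by apply/matrixP => i j; rewrite /X !mxE; ring.
  apply: (le_trans (le_trans (kA u) (ler_wpM2l k0 u_rho))).
  have -> : k * rho = 2 * (eta * k * W) * t by rewrite /rho; ring.
  by rewrite ler_wpM2r ?(ltW t0)//; lra.
have -> : G (X u) = rem (X u) + (X u - xbar) *m L by rewrite /rem subrK.
have -> : X u - xbar = t *: w + u *m A by rewrite /X addrAC subrr add0r.
by rewrite mulmxDl -mulmxA AL mulmx1 {2}uE addrCA subrr addr0 -scalemxAl.
Qed.

(** * Tangent directions and the Jacobian *)

Lemma cvg_mulmx (R : realType) (n p : nat) (q : nat -> 'rV[R]_n) (w : 'rV[R]_n)
    (L : 'M[R]_(n, p)) :
  q k @[k --> \oo] --> w -> (q k *m L) @[k --> \oo] --> w *m L.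
Proof.
move=> qw; apply/cvgrPdist_lt => e e0.
have C0 : 0 < n%:R * `|L| + 1 by rewrite ltr_wpDl// mulr_ge0.
have e1 : 0 < e / (n%:R * `|L| + 1) by rewrite divr_gt0.
move/cvgrPdist_lt: qw => /(_ _ e1); apply: filterS => k.
rewrite ltr_pdivlMr// => h; rewrite -mulmxBl.
apply: le_lt_trans (ler_norm_mulmx _ _) _; apply: le_lt_trans h.
by rewrite mulrAC mulrC ler_wpM2l// lerDl.
Qed.

(** Divided by [tau k], the linearisation error at [x k] is a vanishing multiple
    of the convergent, hence bounded, quotient [(tau k)^-1 *: (x k - xbar)]. *)
Lemma strict_derivative_tangent (R : realType) (n p : nat)
    (G : 'rV[R]_n -> 'rV[R]_p) (xbar : 'rV[R]_n) (L : 'M[R]_(n, p))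
    (x : nat -> 'rV[R]_n) (tau : nat -> R) (w : 'rV[R]_n) :
  G xbar = 0 -> strict_derivative G xbar L ->
  x k @[k --> \oo] --> xbar -> (forall k, 0 < tau k) ->
  (tau k)^-1 *: (x k - xbar) @[k --> \oo] --> w ->
  (tau k)^-1 *: G (x k) @[k --> \oo] --> w *m L.
Proof.
move=> G0 strictG xx tau0 qw; set q := fun k => _ in qw.
have qL := cvg_mulmx (L := L) qw.
have -> : (fun k => (tau k)^-1 *: G (x k)) =
    (fun k => ((tau k)^-1 *: G (x k) - q k *m L) + q k *m L).
  by apply/funext => k; rewrite subrK.
rewrite -[w *m L]add0r; apply: cvgD => //.
apply/cvgr0Pnorm_lt => e e0.
have W0 : 0 < `|w| + 1 by rewrite ltr_wpDl.
have e1 : 0 < e / (`|w| + 1) by rewrite divr_gt0.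
have [d d0 Gd] := strictG _ e1.
move/cvgrPdist_lt: xx => /(_ _ d0) xd.
move/cvg_norm: qw => /cvgrPdist_lt/(_ _ ltr01) q1.
near=> k.
have xkd : `|x k - xbar| < d by rewrite distrC; near: k.
have qk1 : `|q k| < `|w| + 1.
  have : `| `|w| - `|q k| | < 1 by near: k.
  by rewrite ltr_norml => /andP[]; lra.
have := Gd _ xbar xkd; rewrite subrr normr0 => /(_ d0); rewrite G0 subr0 => h.
have -> : (tau k)^-1 *: G (x k) - q k *m L =
    (tau k)^-1 *: (G (x k) - (x k - xbar) *m L).
  by rewrite scalerBr /q scalemxAl.
rewrite normrZ gtr0_norm ?invr_gt0//.
apply: (@le_lt_trans _ _ (e / (`|w| + 1) * `|q k|)).
  rewrite /q normrZ (gtr0_norm (x := (tau k)^-1)) ?invr_gt0//.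
  by rewrite mulrCA ler_wpM2l// invr_ge0 ltW.
by rewrite mulrAC ltr_pdivrMr// ltr_pM2l.
Unshelve. all: by end_near. Qed.

(** The converse half: letting [e] tend to zero in [lyusternik] produces a
    sequence of solutions with [w] as limiting direction. *)
Lemma lyusternik_tangent_cone (R : realType) (n p : nat)
    (G : 'rV[R]_n -> 'rV[R]_p) (xbar : 'rV[R]_n) (L : 'M[R]_(n, p))
    (A : 'M[R]_(p, n)) (w : 'rV[R]_n) (M : set 'rV[R]_n) :
  G xbar = 0 -> strict_derivative G xbar L -> A *m L = 1%:M ->
  (forall x t, 0 < t -> G x = t *: (w *m L) -> M x) -> tangent_cone M xbar w.
Proof.
move=> G0 strictG AL GM.
have harm0 : (k.+1%:R^-1 : R) @[k --> \oo] --> (0 : R) by exact: cvg_harmonic.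
have curve k : exists tx : R * 'rV[R]_n, [/\ 0 < tx.1, tx.1 < k.+1%:R^-1,
    `|tx.2 - xbar - tx.1 *: w| <= k.+1%:R^-1 * tx.1 &
    G tx.2 = tx.1 *: (w *m L)].
  have k0 : 0 < k.+1%:R^-1 :> R by rewrite invr_gt0.
  by have [t [x h]] := lyusternik w G0 strictG AL k0;
  exists (t, x).
have [tx txP] := choice curve.
pose tau k := (tx k).1; pose x k := (tx k).2.
have tau0 k : 0 < tau k by have [] := txP k.
have tau_cvg : tau k @[k --> \oo] --> (0 : R).
  apply: (@squeeze_cvgr _ _ _ _ (fun=> 0) (fun k => k.+1%:R^-1)) => //.
    by apply: nearW => k; have [_ /ltW -> _ _] := txP k; rewrite ltW ?tau0.
  exact: cvg_cst.
have q_cvg : (tau k)^-1 *: (x k - xbar) @[k --> \oo] --> w.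
  apply/cvgrPdist_le => e e0.
  move/cvgrPdist_le: harm0 => /(_ _ e0); apply: filterS => k.
  rewrite sub0r normrN gtr0_norm ?invr_gt0// => ke; apply: le_trans ke.
  have [_ _ h _] := txP k.
  have -> : w - (tau k)^-1 *: (x k - xbar) =
      - ((tau k)^-1 *: (x k - xbar - tau k *: w)).
    by rewrite [in RHS]scalerBr scalerA mulVf ?gt_eqF// scale1r opprB.
  rewrite normrN normrZ gtr0_norm ?invr_gt0//.
  by rewrite mulrC ler_pdivrMr.
exists x, tau; split => //.
- by move=> k; have [t0 _ _ Gx] := txP k; exact: GM Gx.
- have -> : x = (fun k => xbar + tau k *: ((tau k)^-1 *: (x k - xbar))).
    apply/funext => k; rewrite scalerA mulfV ?gt_eqF// scale1r.
    by rewrite addrC subrK.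
  rewrite -[X in _ --> X]addr0; apply: cvgD; first exact: cvg_cst.
  by rewrite -(scale0r w); exact: cvgZ.
Qed.

(** Finitely many components need only one radius, the least of theirs, because
    the norm is the sup norm. *)
Lemma strict_derivative_row (R : realType) (n p : nat)
    (F : 'I_p -> 'rV[R]_n -> R) (xbar : 'rV[R]_n) :
  (forall j x, differentiable (F j) x) ->
  (forall j, {for xbar, continuous (gradient (F j))}) ->
  strict_derivative (fun x => \row_j F j x) xbar
    (\matrix_(a, j) gradient (F j) xbar 0 a).
Proof.
move=> dF cF e e0.
have strictF j : exists d : R, 0 < d /\ forall x y,
    `|x - xbar| < d -> `|y - xbar| < d ->
    `|F j x - F j y - inner (gradient (F j) xbar) (x - y)| <= e * `|x - y|.
  have [d d0 h] := strict_differentiability (dF j) (cF j) e0.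
  by exists d.
have [d dP] := choice strictF.
exists (\big[Num.min/1]_j d j).
  by apply: lt_bigmin => // j _; have [] := dP j.
move=> x y xd yd; apply: mx_norm_le => [|i j]; first by rewrite mulr_ge0// ltW.
have dj : \big[Num.min/1]_j d j <= d j by exact: bigmin_le.
have [_ /(_ x y (lt_le_trans xd dj) (lt_le_trans yd dj))] := dP j.
rewrite !ord1 !mxE; congr (`|_ - _| <= _).
by apply: eq_bigr => k _; rewrite !mxE mulrC.
Qed.

(** * The constraints as a single map *)

Lemma enum_ordD (p q : nat) :
  enum 'I_(p + q) = [seq lshift q i | i <- enum 'I_p] ++
                    [seq rshift p i | i <- enum 'I_q].
Proof.
apply: (inj_map (@ord_inj _)); rewrite map_cat.
rewrite -(map_comp _ (@lshift p q)) -(map_comp _ (@rshift p q)).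
rewrite (val_enum_ord (p + q)) iotaD add0n -(val_enum_ord p).
congr (_ ++ _).
rewrite -{1}[p]addn0 iotaDl -(val_enum_ord q) -(map_comp _ val).
exact: eq_map.
Qed.

(** Both families of constraint functions, and likewise of multipliers, are
    gathered into one family over ['I_(m + m)], so that the constraints form a
    single map with a single Jacobian. *)
Definition stack (T : Type) (m : nat) (F1 F2 : 'I_m -> T)
    (j : 'I_(m + m)) : T :=
  match fintype.split j with inl i => F1 i | inr i => F2 i end.

Lemma stack_lshift (T : Type) (m : nat) (F1 F2 : 'I_m -> T) i :
  stack F1 F2 (lshift m i) = F1 i.
Proof. by rewrite /stack (unsplitK (inl i)). Qed.

Lemma stack_rshift (T : Type) (m : nat) (F1 F2 : 'I_m -> T) i :
  stack F1 F2 (rshift m i) = F2 i.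
Proof. by rewrite /stack (unsplitK (inr i)). Qed.

Lemma stack_ind (T : Type) (m : nat) (F1 F2 : 'I_m -> T) (P : T -> Prop) :
  (forall i, P (F1 i)) -> (forall i, P (F2 i)) -> forall j, P (stack F1 F2 j).
Proof. by move=> P1 P2 j; rewrite /stack; case: (fintype.split j). Qed.

Definition stack_gradients (R : realType) (n m : nat)
    (F1 F2 : 'I_m -> 'rV[R]_n -> R) (xbar : 'rV[R]_n) : 'M[R]_(n, m + m) :=
  \matrix_(a, j) gradient (stack F1 F2 j) xbar 0 a.

Definition stack_values (R : realType) (n m : nat)
    (F1 F2 : 'I_m -> 'rV[R]_n -> R) (x : 'rV[R]_n) : 'rV[R]_(m + m) :=
  \row_j stack F1 F2 j x.

(** When all constraints are biactive, the independent vectors are exactly the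
    columns of the Jacobian, so its transpose has full row rank. *)
Lemma licq_left_inverse (R : realType) (n m : nat)
    (F1 F2 : 'I_m -> 'rV[R]_n -> R) (xbar : 'rV[R]_n) :
  sno_licq F1 F2 xbar -> (forall i, F1 i xbar = 0 /\ F2 i xbar = 0) ->
  exists A, A *m stack_gradients F1 F2 xbar = 1%:M.
Proof.
move=> licq F0.
pose X := [tuple gradient (stack F1 F2 j) xbar | j < m + m].
have freeX : free X.
  move: licq; rewrite /sno_licq !(@eq_filter _ _ predT) ?filter_predT.
  - suff -> : [seq gradient (F1 i) xbar | i <- enum 'I_m] ++
      [seq gradient (F2 i) xbar | i <- enum 'I_m] = X by [].
    rewrite /= enum_ordD map_cat -!map_comp; congr (_ ++ _).
      by apply: eq_map => i /=; rewrite stack_lshift.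
    by apply: eq_map => i /=; rewrite stack_rshift.
  - by move=> i; have [_ ->] := F0 i; rewrite eqxx.
  - by move=> i; have [-> _] := F0 i; rewrite eqxx.
have /row_freeP[B LB] : row_free (stack_gradients F1 F2 xbar)^T.
  apply: inj_row_free => v vL.
  apply/rowP => j; rewrite mxE.
  apply: (freeP freeX (fun j => v 0 j)); rewrite -[RHS]vL.
  apply/rowP => a; rewrite summxE [RHS]mxE; apply: eq_bigr => k _.
  by rewrite -tnth_nth tnth_mktuple !mxE.
by exists B^T; rewrite -[LHS]trmxK trmx_mul trmxK LB trmx1.
Qed.

(** * Multipliers and the five cones *)

Lemma cone_scale (R : realType) (K : sno_type) (t a1 a2 : R) :
  0 < t -> cone K (a1, a2) -> cone K (t * a1, t * a2).
Proof.
move=> /ltW t0; case: K => /=; rewrite 1?mulrACA.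
- by move=> [-> a1_0 a2_0]; rewrite mulr0; split => //; exact: mulr_ge0.
- move=> [a1_0 a12]; split; first exact: mulr_ge0.
  by apply: mulr_ge0_le0 => //; exact: mulr_ge0.
- by move=> [-> a2_0]; rewrite mulr0; split => //; exact: mulr_ge0.
- by move=> ->; rewrite mulr0.
- by move=> [a_0|a_0]; [left|right]; exact: mulr_ge0.
Qed.

Lemma cone0 (R : realType) (K : sno_type) : cone K (0 : R, 0 : R).
Proof. by case: K => /=; rewrite ?mulr0; try split=> //; left. Qed.

(** The sign conditions are designed for this: a pair with
    T-stationary signs that is zero or has no saddle signs lies in the dual
    cone, which is the nonnegative quadrant for [MPCC], the half-lines
    [l1 >= 0, l2 = 0] for [MPVC] and [l1 = 0, l2 >= 0] for [MPOC], and the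
    origin for [MPSC] and [MPDC]. *)
Lemma pairing_ge0_cone (R : realType) (K : sno_type) (l1 l2 a1 a2 : R) :
  T_sign K l1 l2 -> ((l1, l2) <> (0, 0) -> ~ saddle_sign K l1 l2) ->
  cone K (a1, a2) -> 0 <= l1 * a1 + l2 * a2.
Proof.
have [[-> ->]|l0] := pselect ((l1, l2) = (0, 0)).
  by move=> *; rewrite !mul0r addr0.
move=> T /(_ l0) S; case: K T S => /=.
- move=> T S [_ a1_0 a2_0].
  have [l1_0 l2_0] : 0 <= l1 /\ 0 <= l2.
    have [l1_0|l1_0] := leP l1 0; have [l2_0|l2_0] := leP l2 0.
    + by case: S.
    + by move: T; rewrite pmulr_lge0// => ->; rewrite ltW.
    + by move: T; rewrite pmulr_rge0// => ->; rewrite ltW.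
    + by rewrite !ltW.
  by rewrite addr_ge0// mulr_ge0.
- move=> [T l2_0] S [a1_0 _].
  have l1_0 : 0 < l1 by rewrite ltNge; apply/negP => ?; apply: S.
  have -> : l2 = 0 by apply/eqP; rewrite eq_le l2_0 -(pmulr_rge0 _ l1_0).
  by rewrite mul0r addr0 mulr_ge0// ltW.
- move=> T /negP; rewrite -ltNge => l2_0 [_ a2_0].
  case: T => [->|/(lt_le_trans l2_0)]; last by rewrite ltxx.
  by rewrite mul0r add0r mulr_ge0// ltW.
- by move=> _ [].
- by move=> T [].
Qed.

(** Conversely, a nonzero pair of saddle type lies outside the dual cone: for
    all five cones one of [(- l1, 0)] and [(0, - l2)] witnesses it. *)
Lemma descent_in_cone (R : realType) (K : sno_type) (l1 l2 : R) :
  (l1, l2) <> (0, 0) -> saddle_sign K l1 l2 ->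
  exists a1 a2, cone K (a1, a2) /\ l1 * a1 + l2 * a2 < 0.
Proof.
move=> l0 S; have [l1_0|l1_0] := eqVneq l1 0; last first.
  exists (- l1), 0; split; last first.
    by rewrite mulr0 addr0 mulrN oppr_lt0 -expr2 exprn_even_gt0.
  by case: K S => /=; rewrite ?mulr0 ?oppr_ge0 //; [case|case|right].
exists 0, (- l2); split.
  by case: K S => /=; rewrite ?mul0r ?oppr_ge0 //; [case|left].
rewrite mulr0 add0r mulrN oppr_lt0 -expr2 exprn_even_gt0//=.
by apply/eqP => l2_0; apply: l0; rewrite l1_0 l2_0.
Qed.

Lemma mulmx_stack (R : realType) (m : nat) (y : 'rV[R]_(m + m))
    (l1 l2 : 'I_m -> R) :
  (y *m \col_j stack l1 l2 j) 0 0 =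
  \sum_i (l1 i * y 0 (lshift m i) + l2 i * y 0 (rshift m i)).
Proof.
rewrite mxE big_split_ord/= big_split/=; congr (_ + _); apply: eq_bigr => i _.
  by rewrite mxE stack_lshift mulrC.
by rewrite mxE stack_rshift mulrC.
Qed.

(** By the multiplier rule the directional derivative of [f] depends on [w]
    only through the linearised constraint values [w *m L]. *)
Lemma inner_multipliers (R : realType) (n m : nat) (K : sno_type)
    (f : 'rV[R]_n -> R) (F1 F2 : 'I_m -> 'rV[R]_n -> R) (xbar : 'rV[R]_n)
    (l1 l2 : 'I_m -> R) (w : 'rV[R]_n) :
  (forall i, F1 i xbar = 0 /\ F2 i xbar = 0) ->
  T_multipliers K f F1 F2 xbar l1 l2 ->
  inner (gradient f xbar) w =
  (w *m stack_gradients F1 F2 xbar *m \col_j stack l1 l2 j) 0 0.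
Proof.
move=> F0 [-> _]; rewrite mulmx_stack.
rewrite (eq_bigl xpredT) => [|i]; last first.
  by rewrite inE (F0 i).1 (F0 i).2 eqxx.
transitivity (\sum_k \sum_i (l1 i *: gradient (F1 i) xbar +
    l2 i *: gradient (F2 i) xbar) 0 k * w 0 k).
  by apply: eq_bigr => k _; rewrite summxE mulr_suml.
rewrite exchange_big/=; apply: eq_bigr => i _.
rewrite !mxE !mulr_sumr -big_split/=; apply: eq_bigr => k _.
by rewrite !mxE stack_lshift stack_rshift; ring.
Qed.

(** * The equivalence *)

Unset Implicit Arguments.

Theorem proposition10 (R : realType) (n m : nat) (K : sno_type)
    (f : 'rV[R]_n -> R) (F1 F2 : 'I_m -> 'rV[R]_n -> R) (xbar : 'rV[R]_n)
    (f_C2 : twice_continuously_differentiable f)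
    (F1_C2 : forall i, twice_continuously_differentiable (F1 i))
    (F2_C2 : forall i, twice_continuously_differentiable (F2 i))
    (xbar_feasible : feasible K F1 F2 xbar)
    (xbar_licq : sno_licq F1 F2 xbar)
    (xbar_biactive : forall i, F1 i xbar = 0 /\ F2 i xbar = 0)
    (xbar_T : T_stationary K f F1 F2 xbar) :
  ~ frechet_stationary f (feasible K F1 F2) xbar <->
  first_order_saddle K f F1 F2 xbar.
Proof.
set G := stack_values F1 F2; set L := stack_gradients F1 F2 xbar.
have G0 : G xbar = 0.
  apply/rowP => j; rewrite !mxE.
  by apply: (stack_ind (P := fun g => g xbar = 0)) => i;
    have [] := xbar_biactive i.
have F_C2 := @stack_ind _ _ F1 F2 _ F1_C2 F2_C2.
have strictG : strict_derivative G xbar L.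
  apply: strict_derivative_row => [j x|j]; have [dF dgF _] := F_C2 j => //.
  exact: differentiable_continuous.
have biact i : i \in biactive F1 F2 xbar.
  by rewrite inE; have [-> ->] := xbar_biactive i; rewrite eqxx.
have G1 x i : G x 0 (lshift m i) = F1 i x by rewrite mxE stack_lshift.
have G2 x i : G x 0 (rshift m i) = F2 i x by rewrite mxE stack_rshift.
split=> [|[_ [l1 [l2 [mult [i0 [_ l0 sgn]]]]]]].
- apply: contra_notP => no_saddle.
  have [_ [l1 [l2 mult]]] := xbar_T.
  split=> //; exists (- gradient f xbar); last by rewrite subrr.
  move=> w [x [tau [Mx xx tau0 _ qw]]].
  rewrite innerN (inner_multipliers _ xbar_biactive mult) oppr_le0.
  set lam := \col_j _.
  have Gq := strict_derivative_tangent G0 strictG xx tau0 qw.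
  have Gql := cvg_mulmx (L := lam) Gq.
  have cv : ((tau k)^-1 *: G (x k) *m lam) 0 0 @[k --> \oo] -->
      (w *m L *m lam) 0 0.
    apply: (cvg_comp _ (fun M : 'M[R]_(1, 1) => M 0 0) Gql).
    exact: coord_continuous.
  rewrite -(cvg_lim _ cv)//; apply: limr_ge; first exact: cvgP cv.
  apply: nearW => k.
  rewrite mulmx_stack; apply: sumr_ge0 => i _; rewrite !mxE -/G.
  rewrite stack_lshift stack_rshift.
  have k0 : 0 < (tau k)^-1 by rewrite invr_gt0.
  apply: pairing_ge0_cone (cone_scale k0 (Mx k i)).
    by case: mult => _; exact.
  move=> l0 S; apply: no_saddle; split => //.
  by exists l1, l2; split => //; exists i.
- have [A AL] := licq_left_inverse xbar_licq xbar_biactive.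
  have [a1 [a2 [Ka la]]] := descent_in_cone l0 sgn.
  (* Only the constraint pair [i0] moves, along a descent direction of its cone;
     the other pairs stay at the origin, which is in the cone. *)
  pose v : 'rV[R]_(m + m) := \row_j
    stack (fun i => if i == i0 then a1 else 0)
          (fun i => if i == i0 then a2 else 0) j.
  have vL : v *m A *m L = v by rewrite -mulmxA AL mulmx1.
  case=> _ [u Nu /esym/eqP]; rewrite addr_eq0 => /eqP fu.
  have : inner u (v *m A) <= 0.
    apply: Nu; apply: lyusternik_tangent_cone G0 strictG AL _ => x t t0 Gx i.
    rewrite -G1 -G2 Gx vL !mxE stack_lshift stack_rshift.
    by apply: cone_scale => //; case: (i == i0) => //; exact: cone0.
  have -> : u = - gradient f xbar by rewrite fu opprK.
  rewrite innerN (inner_multipliers _ xbar_biactive mult).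
  rewrite vL mulmx_stack (bigD1 i0)//= big1 => [|i /negPf ii0].
    rewrite !mxE stack_lshift stack_rshift eqxx addr0; lra.
  by rewrite !mxE stack_lshift stack_rshift ii0 !mulr0 addr0.
Qed.
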